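(* Let $I,J\subset S=K[x_1,\ldots,x_n]$ be two nonzero monomial ideals of Borel type. Then \[ \mathrm{reg}(I\cdot J) \leq \mathrm{reg}(I) + \mathrm{reg}(J).\]
   Context: $K$ is an infinite field, $n\geq 2$, and $S=K[x_1,\ldots,x_n]$ is the polynomial ring with its standard grading. A monomial ideal $I\subset S$ is of Borel type if $(I:x_j^\infty)=(I:(x_1,\ldots,x_j)^\infty)$ for all $j=1,\ldots,n$, where $(I:L^\infty)=\bigcup_{k\ge 1}(I:L^k)$ for an ideal $L$ and $(I:x_j^\infty)=(I:(x_j)^\infty)$. The (Castelnuovo-Mumford) regularity is $\mathrm{reg}(I)=\max\{j-i : \beta_{ij}(I)\neq 0\}$, where $\beta_{ij}(I)=\dim_K \mathrm{Tor}_i^S(I,K)_j$ are the graded Betti numbers of $I$. *)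

(* Defs.v *)
From HB Require Import structures.
From mathcomp Require Import all_boot all_order all_algebra.
From mathcomp Require Import mpoly.

Set Implicit Arguments.
Unset Strict Implicit.
Unset Printing Implicit Defensive.

Import Order.TTheory GRing.Theory Num.Theory.
Local Open Scope ring_scope.

Section Ideals.
Variables (n : nat) (K : fieldType).
Local Notation S := {mpoly K[n]}.
Implicit Types (I J L G : S -> Prop).

Definition ideal_span G : S -> Prop := fun f =>
  exists2 s : seq (S * S),
    forall p, p \in s -> G p.2 & f = \sum_(p <- s) p.1 * p.2.

Definition monomial_ideal I : Prop :=
  exists M : 'X_{1..n} -> Prop,
    forall f, I f <-> ideal_span (fun g => exists2 m, M m & g = 'X_[m]) f.

Definition nonzero_ideal I : Prop := exists2 f, I f & f != 0.

Definition ideal_mul I J : S -> Prop :=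
  ideal_span (fun h => exists f g, [/\ I f, J g & h = f * g]).

Fixpoint ideal_pow L (k : nat) : S -> Prop :=
  if k is k'.+1 then ideal_mul L (ideal_pow L k') else fun _ => True.

Definition ideal_colon I L : S -> Prop := fun f => forall g, L g -> I (f * g).

Definition ideal_saturation I L : S -> Prop := fun f =>
  exists2 k, (1 <= k)%N & ideal_colon I (ideal_pow L k) f.

Definition var_ideal (j : 'I_n) : S -> Prop := ideal_span (fun g => g = 'X_j).

(* Variables are indexed from 0, so this is the ideal generated by all the
   variables up to and including 'X_j. *)
Definition vars_upto_ideal (j : 'I_n) : S -> Prop :=
  ideal_span (fun g => exists2 i : 'I_n, (i <= j)%N & g = 'X_i).

Definition borel_type I : Prop :=
  monomial_ideal I /\
  forall (j : 'I_n) f, ideal_saturation I (var_ideal j) f <->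
                       ideal_saturation I (vars_upto_ideal j) f.

(* A graded resolution ... -> F_2 -> F_1 -> F_0 -> I -> 0 by finitely generated
   graded free modules F_i = \bigoplus_k S(- gdeg i k), k < rk i. Elements of
   F_i are row vectors, and the maps act by multiplication on the right. The
   two homogeneity fields say that these maps have degree 0; zero entries have
   empty support and are unconstrained. *)
Record graded_free_resolution I := GradedFreeResolution {
  rk : nat -> nat;
  gdeg : forall i, 'I_(rk i) -> int;
  dif : forall i, 'M[S]_(rk i.+1, rk i);
  aug : 'cV[S]_(rk 0);
  dif_homog : forall i a b m, m \in msupp (dif i a b) ->
    gdeg a = gdeg b + (mdeg m)%:Z;
  aug_homog : forall a m, m \in msupp (aug a 0) -> gdeg a = (mdeg m)%:Z;
  aug_image : forall f, I f <-> exists v : 'rV[S]_(rk 0), f = (v *m aug) 0 0;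
  aug_exact : forall v : 'rV[S]_(rk 0),
    v *m aug = 0 <-> exists w : 'rV[S]_(rk 1), v = w *m dif 0;
  dif_exact : forall i (v : 'rV[S]_(rk i.+1)),
    v *m dif i = 0 <-> exists w : 'rV[S]_(rk i.+2), v = w *m dif i.+1
}.

Section Tor.
Variables (I : S -> Prop) (F : graded_free_resolution I).

(* K = S / (x_1, ..., x_n), so F_i (x)_S K = K^(rk i), and its differential is
   obtained by taking constant coefficients. *)
Definition fiber_dif i : 'M[K]_(rk F i.+1, rk F i) :=
  map_mx (mcoeff 0%MM) (dif F i).

(* Its row space is the degree j component of F_i (x)_S K. *)
Definition fiber_deg i (j : int) : 'M[K]_(rk F i) :=
  diag_mx (\row_k (gdeg (g := F) k == j)%:R).

Definition tor_cycles i (j : int) : 'M[K]_(rk F i) :=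
  match i return 'M[K]_(rk F i) with
  | 0 => fiber_deg 0 j
  | i'.+1 => (fiber_deg i'.+1 j :&: kermx (fiber_dif i'))%MS
  end.

Definition tor_boundaries i (j : int) : 'M[K]_(rk F i.+1, rk F i) :=
  fiber_deg i.+1 j *m fiber_dif i.

Lemma tor_boundaries_sub i j : (tor_boundaries i j <= tor_cycles i j)%MS.
Proof.
have sub_deg i0 : (tor_boundaries i0 j <= fiber_deg i0 j)%MS.
  suff -> : tor_boundaries i0 j = tor_boundaries i0 j *m fiber_deg i0 j.
    exact: submxMl.
  apply/matrixP => a b.
  rewrite /tor_boundaries /fiber_deg mul_mx_diag mul_diag_mx !mxE.
  case: (gdeg a =P j) => [da|_]; last by rewrite !mul0r.
  case: (gdeg b =P j) => [_|db]; first by rewrite mulr1.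
  rewrite mul1r mulr0; apply/eqP; rewrite mcoeff_eq0; apply/negP.
  by move/dif_homog; rewrite mdeg0 addr0 => dab; apply: db; rewrite -dab.
case: i => [|i] //=; rewrite sub_capmx sub_deg /=; apply/sub_kermxP.
rewrite /tor_boundaries -mulmxA -map_mxM /=.
suff -> : dif F i.+1 *m dif F i = 0 by rewrite map_mx0 mulmx0.
apply/row_matrixP => k; rewrite row_mul row0; apply/dif_exact.
by exists (delta_mx 0 k); rewrite -rowE.
Qed.

(* dim_K Tor_i^S(I, K)_j, the homology of F (x)_S K. By tor_boundaries_sub the
   subtraction is not truncated. As usual for Tor, the value does not depend on
   the resolution F of I. *)
Definition graded_betti i (j : int) : nat :=
  (\rank (tor_cycles i j) - \rank (tor_boundaries i j))%N.

End Tor.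

(* reg I = r, that is, r = max {j - i | beta_ij(I) <> 0}. *)
Definition is_regularity I (r : int) : Prop :=
  exists F : graded_free_resolution I,
    (exists (i : nat) (j : int), graded_betti F i j != 0%N /\ r = j - i%:Z) /\
    (forall (i : nat) (j : int), graded_betti F i j != 0%N -> j - i%:Z <= r).

End Ideals.

(* Main.v *)
Require Import Defs.
From mathcomp Require Import all_boot all_order all_algebra.
From mathcomp Require Import zify ring.
From mathcomp Require Import mpoly.
From Stdlib Require Import Classical_Prop.

(* Write last(b) for the last variable of a monomial b. Call a monomial ideal
   e-divisible if b / last(b) is in it for each of its monomials b with
   deg b > e (last_div below). Koszul homology computes Tor_i(I, K), so:
   - If I is of Borel type and reg I <= r, then I is r-divisible. Otherwise
     some w = b / x_m of degree >= r is not in I, although x_m w is, and b only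
     involves the variables up to x_m. By the Borel condition a multiple v of
     w in these variables is not in I while all x_l v with l <= m are, and the
     cycle d(v e_0 ... e_m) has a nonzero class, in Tor_m(I, K) and in degree
     deg v + m + 1 > r + m.
   - If I is r-divisible and J is s-divisible, then IJ is (r + s)-divisible:
     in a product of b1 and b2, keep moving last(b1) to the factor b2, which
     contains the last variable of b1 b2, until deg b2 > s.
   - If L is e-divisible, then reg L <= e: in internal degrees > e + i, the
     cone with apex the last variable of the multidegree contracts the Koszul
     complex of L in exterior degree i. *)

Import Order.TTheory GRing.Theory Num.Theory.
Local Open Scope ring_scope.

Set Implicit Arguments.
Unset Strict Implicit.
Unset Printing Implicit Defensive.

(** * The Koszul complex of a free module and its cone homotopy *)

Section Koszul.
Variables (n : nat) (K : fieldType).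
Local Notation S := {mpoly K[n]}.
Implicit Types (b : 'X_{1..n}) (s : {set 'I_n}) (i j k l m : 'I_n).

Definition supp_le m b := [forall l : 'I_n, (m < l)%N ==> (b l == 0%N)].

Lemma supp_leP m b :
  reflect (forall l, (m < l)%N -> b l = 0%N) (supp_le m b).
Proof. by apply: (iffP 'forall_implyP) => h l /h /eqP. Qed.

Lemma mcoeffXUM k (p : S) b :
  ('X_k * p)@_b = if (0 < b k)%N then p@_(b - U_(k)) else 0.
Proof.
case: ifPn => bk.
  rewrite -{1}(@submK _ U_(k)%MM b) ?lep1mP -?lt0n // addmC mulrC.
  exact: mcoeffMX.
apply/eqP; rewrite mcoeff_eq0; apply: contra bk; rewrite mulrC => h.
have := perm_mem (msuppMX p U_(k)) b.
rewrite h => /esym/mapP[b' _ ->]; by rewrite mnmDE mnm1E eqxx addnC addn1.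
Qed.

(** The elements above k are counted, not those below, so that the apex of the cone below, a top
    element, gets the sign 1. *)
Definition ksign k s : K := (-1) ^+ #|[set l in s | (k < l)%N]|.

Lemma ksign_top k s : (forall l, l \in s -> (l <= k)%N) -> ksign k s = 1.
Proof.
move=> h; rewrite /ksign (_ : [set l in s | _] = set0) ?cards0 //.
apply/setP=> l; rewrite !inE; apply/negP => /andP[/h]; lia.
Qed.

Lemma ksign_setU1 k l s : l \notin s ->
  ksign k (l |: s) = (-1) ^+ (k < l)%N * ksign k s.
Proof.
move=> ls; rewrite /ksign -exprD; congr (_ ^+ _).
case: ltnP => kl; rewrite /= ?add0n ?add1n.
  rewrite (_ : finset _ = l |: [set x in s | (k < x)%N]).
    by rewrite cardsU1 !inE (negbTE ls).
  by apply/setP => x; rewrite !inE; case: eqP => // ->; rewrite kl.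
apply/eq_card => x; rewrite !inE; case: eqP => // ->.
by rewrite ltnNge kl !andbF.
Qed.

(* A Koszul chain with values in the free module S^r: c s is the coefficient
   of the exterior monomial e_s, and all exterior degrees are allowed. *)
Definition kchain r := {set 'I_n} -> 'rV[S]_r.

Definition kdiff r (c : kchain r) : kchain r := fun s =>
  \sum_(k | k \notin s) (ksign k s *: 'X_k : S) *: c (k |: s).

Lemma kdiffB r (c c' : kchain r) s :
  kdiff (fun s => c s - c' s) s = kdiff c s - kdiff c' s.
Proof. by rewrite -sumrB; apply: eq_bigr => k _; rewrite scalerBr. Qed.

Lemma kdiff_mulmx r q (A : 'M[S]_(r, q)) (c : kchain r) s :
  kdiff (fun s => c s *m A) s = kdiff c s *m A.
Proof. by rewrite mulmx_suml; apply: eq_bigr => k _; rewrite scalemxAl. Qed.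

Lemma eq_kdiff r (c c' : kchain r) : c =1 c' -> kdiff c =1 kdiff c'.
Proof. by move=> h s; apply: eq_bigr => k _; rewrite h. Qed.

Lemma mcoeff_kdiff r (c : kchain r) s a b :
  (kdiff c s 0 a)@_b =
  \sum_(k | (k \notin s) && (0 < b k)%N)
     ksign k s * (c (k |: s) 0 a)@_(b - U_(k)).
Proof.
rewrite summxE raddf_sum /= big_mkcondr; apply: eq_bigr => k _.
by rewrite mxE -scalerAl mcoeffZ mcoeffXUM; case: ifP; rewrite ?mulr0.
Qed.

(** The terms above the diagonal cancel those below it. The diagonal is a separate hypothesis
    because of characteristic 2. *)
Lemma sum_alternating (V : zmodType) (T : 'I_n -> 'I_n -> V) :
  (forall k, T k k = 0) -> (forall k l, T l k = - T k l) ->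
  \sum_k \sum_l T k l = 0.
Proof.
move=> T0 TN.
have E k : \sum_l T k l =
    \sum_(l : 'I_n | (k < l)%N) T k l + \sum_(l : 'I_n | (l < k)%N) T k l.
  rewrite (bigID (fun l : 'I_n => (k < l)%N)) /=; congr (_ + _).
  rewrite (bigD1 k) ?ltnn //= T0 add0r; apply: eq_bigl => l.
  rewrite -leqNgt [RHS]ltn_neqAle andbC; by [].
rewrite (eq_bigr _ (fun k _ => E k)) big_split /=.
rewrite [X in _ + X](exchange_big_dep predT) //= -big_split big1 // => k _.
by rewrite -big_split big1 //= => l _; rewrite [T l k]TN addrN.
Qed.

Lemma kdiff_kdiff r (c : kchain r) s : kdiff (kdiff c) s = 0.
Proof.
pose T k l : 'rV[S]_r := if [&& k \notin s, l \notin s & k != l] then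
  (ksign k s *: 'X_k * (ksign l (k |: s) *: 'X_l) : S) *: c (l |: (k |: s))
  else 0.
transitivity (\sum_k \sum_l T k l).
  rewrite {1}/kdiff big_mkcond; apply: eq_bigr => k _.
  case: ifPn => ks; last by rewrite big1 // => l _; rewrite /T (negbTE ks).
  rewrite scaler_sumr big_mkcond; apply: eq_bigr => l _.
  rewrite /T ks /= !inE negb_or andbC eq_sym.
  by case: ifP => // _; rewrite scalerA.
apply: sum_alternating => [k|k l]; rewrite /T; first by rewrite eqxx !andbF.
rewrite eq_sym andbCA; case: ifP => [/and3P[ks ls kl]|]; last by rewrite oppr0.
rewrite -scaleNr; congr (_ *: _); last by congr (c _); rewrite setUCA.
(* Exactly one of the two orders of removing k and l contributes an extra sign. *)
rewrite !ksign_setU1 // -!scalerAl -!scalerAr !scalerA -scaleNr [_ * 'X_l]mulrC.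
congr (_ *: _); case: (ltngtP k l) => h; rewrite ?expr0 ?expr1; try ring.
by case/eqP: kl; apply: val_inj.
Qed.

Definition peel m (p : S) : S :=
  \sum_(b <- msupp p | (0 < b m)%N && supp_le m b) p@_b *: 'X_[b - U_(m)].

Lemma mcoeff_peel m p b :
  (peel m p)@_b = if supp_le m b then p@_(b + U_(m)) else 0.
Proof.
have sE : supp_le m (b + U_(m)) = supp_le m b.
  apply: eq_forallb => l; case: ltnP => //= ml; rewrite mnmDE mnm1E.
  by case: (m =P l) ml => [->|_]; rewrite ?ltnn ?addn0.
rewrite raddf_sum /=; under eq_bigr do rewrite mcoeffZ mcoeffX.
have E b' : (0 < b' m)%N -> (b' - U_(m) == b)%MM = (b' == b + U_(m))%MM.
  move=> h; apply/eqP/eqP => [<-|->]; last by rewrite addmK.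
  by rewrite submK // lep1mP -lt0n.
rewrite -sE; case: (boolP (b + U_(m) \in msupp p)%MM) => h.
  rewrite -big_filter; case: ifPn => hs.
    rewrite (bigD1_seq (b + U_(m))%MM) ?filter_uniq ?msupp_uniq //=; last first.
      by rewrite mem_filter h hs mnmDE mnm1E eqxx addn1.
    rewrite addmK eqxx mulr1 big_filter_cond big1 ?addr0 // => b' /andP[/andP[h1 _] h2].
    by rewrite E // (negbTE h2) mulr0.
  rewrite big_filter big1 // => b' /andP[h1 h2].
  rewrite E //; case: eqP => [e|]; rewrite ?mulr0 //.
  by rewrite e (negbTE hs) in h2.
rewrite (memN_msupp_eq0 h) if_same big_seq_cond big1 // => b' /andP[h1 /andP[h2 _]].
by rewrite E //; case: eqP h => [<-|_ _]; rewrite ?h1 ?mulr0.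
Qed.

(* The cone with apex the last variable of the multidegree. *)
Definition kcone r (c : kchain r) : kchain r := fun s =>
  \sum_(m in s | [forall l in s, (l <= m)%N]) \row_a peel m (c (s :\ m) 0 a).

(** The multidegree of x^b e_s is b plus the indicator of s; here x_m is its last variable. *)
Definition last_in m s b :=
  (m \in s) || (0 < b m)%N /\ (forall k, (m < k)%N -> k \notin s /\ b k = 0%N).

Lemma last_in_ex s b : s != set0 \/ b != 0%MM -> exists m, last_in m s b.
Proof.
move=> h; pose P m := (m \in s) || (0 < b m)%N.
have [m0 Pm0] : exists m, P m.
  case: (pickP P) => [m hm|hP]; first by exists m.
  case: h => [/set0Pn[m ms]|/eqP[]]; first by move: (hP m); rewrite /P ms.
  apply/mnmP => k; rewrite mnm0E; apply/eqP; rewrite -leqn0 leqNgt.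
  by move: (hP k); rewrite /P => /negbT; rewrite negb_or => /andP[].
case: (@arg_maxnP _ m0 P (fun m : 'I_n => m : nat) Pm0) => m Pm hm.
exists m; split=> // k mk; have : ~~ P k by apply/negP => /hm; rewrite /= leqNgt mk.
by rewrite negb_or -leqNgt leqn0 => /andP[? /eqP].
Qed.

(** Only the top element k of s occurs in the sum, and [peel] keeps b there only if x_k is also the
    last variable of the multidegree. *)
Lemma mcoeff_kcone r (c : kchain r) s m b a : last_in m s b ->
  (kcone c s 0 a)@_b =
  if m \in s then (c (s :\ m) 0 a)@_(b + U_(m)) else 0.
Proof.
case=> hm hk; rewrite summxE raddf_sum /=.
under eq_bigr do rewrite mxE mcoeff_peel.
case: ifPn => ms.
  rewrite (bigD1 m) /=; last first.
    rewrite ms; apply/forall_inP => l ls; rewrite leqNgt; apply/negP => /hk[].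
    by rewrite ls.
  rewrite big1 ?addr0 => [|k /andP[/andP[ks /forall_inP /(_ _ ms) mk] kd]].
    by case: ifP => // /negP[]; apply/supp_leP => l /hk[].
  have /hk[] : (m < k)%N by rewrite ltn_neqAle mk andbT eq_sym.
  by rewrite ks.
rewrite (negbTE ms) /= in hm.
rewrite big1 // => k /andP[ks _]; case: ifP => // /supp_leP h.
case: (ltngtP k m) => [/h e|/hk[]|e]; first by rewrite e in hm.
  by rewrite ks.
by rewrite -(val_inj e) ks in ms.
Qed.

(* Both operators preserve the multidegree, hence its last variable m. *)
Lemma kcone_homotopy r (c : kchain r) s a b : s != set0 \/ b != 0%MM ->
  (kdiff (kcone c) s 0 a)@_b + (kcone (kdiff c) s 0 a)@_b = (c s 0 a)@_b.
Proof.
case/last_in_ex => m hm; rewrite mcoeff_kdiff (mcoeff_kcone _ _ hm).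
case: (hm) => hm1 hk.
have hmk k : k \notin s -> (0 < b k)%N -> last_in m (k |: s) (b - U_(k)).
  move=> ks bk; split=> [|l ml].
    rewrite !inE mnmBE mnm1E [k == m]eq_sym; case: eqP => //= _.
    by rewrite subn0.
  have [ls bl] := hk _ ml; rewrite !inE negb_or ls andbT mnmBE bl; split=> //.
  by apply/eqP => e; rewrite -e bl in bk.
under eq_bigr => k /andP[ks bk].
  rewrite (mcoeff_kcone _ _ (hmk k ks bk)); over.
(* If m is not in s, only k = m contributes, and [kdiff (kcone c)] alone returns [c s]. *)
case: ifPn => ms; last first.
  rewrite (negbTE ms) /= in hm1; rewrite addr0 (bigD1 m) /= ?ms //.
  rewrite big1 => [|k /andP[_ km]]; last first.
    by rewrite in_setU1 (negbTE ms) orbF eq_sym (negbTE km) mulr0.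
  rewrite setU11 ksign_top => [|l ls]; last first.
    by rewrite leqNgt; apply/negP => /hk[]; rewrite ls.
  by rewrite mul1r addr0 setU1K // submK // lep1mP -lt0n.
(* If m is in s, the term k = m of [kdiff c] returns [c s]; the others cancel against
   [kdiff (kcone c)]. *)
rewrite mcoeff_kdiff [X in _ + X](bigD1 m) /=; last first.
  by rewrite !inE eqxx mnmDE mnm1E eqxx addn1.
rewrite ksign_top => [|l]; last first.
  rewrite !inE => /andP[_ ls]; rewrite leqNgt; apply/negP => /hk[]; by rewrite ls.
rewrite addmK mul1r setD1K // addrCA -[RHS]addr0; congr (_ + _).
rewrite [X in _ + X](eq_bigl (fun k => (k \notin s) && (0 < b k)%N)); last first.
  move=> k; rewrite !inE mnmDE mnm1E [k == m]eq_sym.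
  case: eqP => [<-|] /=; first by rewrite ms andbF.
  by rewrite addn0 andbT.
rewrite -big_split big1 //= => k /andP[ks bk].
have km : k != m by apply: contraNneq ks => ->.
have lkm : (k < m)%N.
  rewrite ltnNge; apply/negP => h; have [] := hk k; first by rewrite ltn_neqAle h eq_sym andbT km.
  by move=> _ e; rewrite e in bk.
(* Adding m > k to the set flips the sign attached to k, whence the cancellation. *)
rewrite !inE ms orbT -{1}(setD1K ms) ksign_setU1 ?setD11 // lkm expr1.
rewrite setUC setDUl (_ : [set k] :\ m = [set k]); last first.
  by apply/setP=> l; rewrite !inE; case: eqP => // ->; rewrite eq_sym (negbTE km).
rewrite [_ :\ _ :|: _]setUC.
rewrite (_ : b + U_(m) - U_(k) = b - U_(k) + U_(m))%MM; first by ring.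
apply/mnmP => l; rewrite !(mnmDE, mnmBE, mnm1E).
by case: (k =P l) bk => [->|_]; case: (m =P l) => [e|]; lia.
Qed.

(** The second term of the homotopy vanishes on cycles. The set s is nonempty because a constant
    term at [set0] has no last variable. *)
Lemma kdiff_kcone r (c : kchain r) s : s != set0 ->
  (forall s, kdiff c s = 0) -> kdiff (kcone c) s = c s.
Proof.
move=> s0 cyc; apply/rowP => a; apply/mpolyP => b.
rewrite -(kcone_homotopy c a (or_introl s0)) -[LHS]addr0; congr (_ + _).
rewrite summxE raddf_sum big1 //= => m _; rewrite mxE mcoeff_peel cyc mxE.
by rewrite mcoeff0 if_same.
Qed.
(** * Koszul homology and free resolutions *)

Implicit Types (D : int -> Prop) (t : int).

(** A general D covers both the elements of degree t and those without a component of degree t. *)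
Definition deg_in r (gd : 'I_r -> int) D (v : 'rV[S]_r) :=
  forall a b, b \in msupp (v 0 a) -> D (gd a + (mdeg b)%:Z).

Definition is_homog r (gd : 'I_r -> int) t := deg_in gd (fun d => d = t).

Definition row_homog r q (gd : 'I_r -> int) (gd' : 'I_q -> int)
    (A : 'M[S]_(r, q)) :=
  forall a a' b, b \in msupp (A a a') -> gd a = gd' a' + (mdeg b)%:Z.

Lemma deg_in_mulmx r q (gd : 'I_r -> int) (gd' : 'I_q -> int) A D v :
  row_homog gd gd' A -> deg_in gd D v -> deg_in gd' D (v *m A).
Proof.
move=> hA hv a b; rewrite mxE => /msupp_sum_le/flattenP[x /mapP[k _ ->]].
case/msuppM_le/allpairsP => -[b1 b2] /= [/hv h1 /hA h2 ->].
by move: h1; rewrite h2 mdegD PoszD -addrA [(mdeg b2)%:Z + _]addrC.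
Qed.

Lemma deg_inB r (gd : 'I_r -> int) D v w :
  deg_in gd D v -> deg_in gd D w -> deg_in gd D (v - w).
Proof.
by move=> hv hw a b; rewrite !mxE => /msuppB_le; rewrite mem_cat => /orP[/hv|/hw].
Qed.

Lemma deg_in0 r (gd : 'I_r -> int) D : deg_in gd D 0.
Proof. by move=> a b; rewrite mxE mcoeff_msupp mcoeff0 eqxx. Qed.

Definition hcomp r (gd : 'I_r -> int) t (v : 'rV[S]_r) : 'rV[S]_r :=
  \row_a \sum_(b <- msupp (v 0 a) | gd a + (mdeg b)%:Z == t)
    (v 0 a)@_b *: 'X_[b].

Lemma mcoeff_hcomp r (gd : 'I_r -> int) t (v : 'rV[S]_r) a b :
  (hcomp gd t v 0 a)@_b = if gd a + (mdeg b)%:Z == t then (v 0 a)@_b else 0.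
Proof.
rewrite mxE raddf_sum /=; under eq_bigr do rewrite mcoeffZ mcoeffX.
case: (boolP (b \in msupp (v 0 a))) => h; last first.
  rewrite (memN_msupp_eq0 h) if_same big_seq_cond big1 // => b' /andP[h1 _].
  by case: eqP h => [<-|_ _]; rewrite ?h1 ?mulr0.
case: ifP => ht.
  rewrite -big_filter (bigD1_seq b) ?filter_uniq ?msupp_uniq ?mem_filter ?ht //=.
  by rewrite eqxx mulr1 big1 ?addr0 // => b' /negbTE->; rewrite mulr0.
by rewrite big1 // => b' h'; case: (b' =P b) h' => [->|_ _]; rewrite ?ht ?mulr0.
Qed.

Lemma hcomp_homog r (gd : 'I_r -> int) t v : is_homog gd t (hcomp gd t v).
Proof.
by move=> a b; rewrite mcoeff_msupp mcoeff_hcomp; case: ifP => [/eqP|]; rewrite ?eqxx.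
Qed.

(** The difference of the two sides is homogeneous of degree t and also has no component of degree
    t. *)
Lemma hcomp_mulmx r q (gd : 'I_r -> int) (gd' : 'I_q -> int) A t v :
  row_homog gd gd' A -> is_homog gd' t (v *m A) -> hcomp gd t v *m A = v *m A.
Proof.
move=> hA hvA; apply/eqP; rewrite eq_sym -subr_eq0; apply/eqP.
have h1 : is_homog gd' t (v *m A - hcomp gd t v *m A).
  by apply: deg_inB => //; apply: deg_in_mulmx hA _; apply: hcomp_homog.
have h2 : deg_in gd' (fun d => d != t) (v *m A - hcomp gd t v *m A).
  rewrite -mulmxBl; apply: deg_in_mulmx hA _ => a b.
  rewrite mcoeff_msupp !mxE mcoeffB; have := mcoeff_hcomp gd t v a b.
  by rewrite mxE => ->; case: ifP => //; rewrite subrr eqxx.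
apply/rowP => a; rewrite [RHS]mxE; apply/msuppnil0.
case E : (msupp _) => [//|b x].
have hb : b \in msupp ((v *m A - hcomp gd t v *m A) 0 a) by rewrite E mem_head.
by have := h2 _ _ hb; rewrite (h1 _ _ hb) eqxx.
Qed.

Definition kcard r p (c : kchain r) := forall s, #|s| != p -> c s = 0.

Definition khomog r (gd : 'I_r -> int) t (c : kchain r) :=
  forall s, is_homog gd (t - #|s|%:Z) (c s).

Lemma kdiff_card r p (c : kchain r) : kcard p.+1 c -> kcard p (kdiff c).
Proof.
move=> h s sp; rewrite /kdiff big1 // => k ks; rewrite h ?scaler0 //.
by rewrite cardsU1 ks add1n.
Qed.

Lemma kcone_card r p (c : kchain r) : kcard p c -> kcard p.+1 (kcone c).
Proof.
move=> h s sp; rewrite /kcone big1 // => k /andP[ks _]; apply/rowP => a.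
rewrite !mxE h ?mxE; last by move: sp; rewrite (cardsD1 k) ks add1n.
by apply/mpolyP => b; rewrite mcoeff_peel !mcoeff0 if_same.
Qed.

Lemma kdiff_homog r (gd : 'I_r -> int) t c :
  khomog gd t c -> khomog gd t (kdiff c).
Proof.
move=> h s a b; rewrite summxE => /msupp_sum_le/flattenP[x /mapP[k]].
rewrite mem_filter => /andP[ks _] ->; rewrite mxE.
case/msuppM_le/allpairsP => -[b1 b2] /= [/msuppZ_le h1 /h].
rewrite cardsU1 ks add1n => h2 ->; move: h1; rewrite msuppX inE => /eqP->.
by rewrite mdegD mdeg1 PoszD addrCA h2 intS; ring.
Qed.

Lemma kcone_homog r (gd : 'I_r -> int) t c :
  khomog gd t c -> khomog gd t (kcone c).
Proof.
move=> h s a b; rewrite summxE => /msupp_sum_le/flattenP[x /mapP[k]].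
rewrite mem_filter => /andP[/andP[ks _] _] ->; rewrite mxE.
rewrite mcoeff_msupp mcoeff_peel; case: ifP => [_|]; last by rewrite eqxx.
rewrite -mcoeff_msupp => /h; rewrite mdegD mdeg1 [X in _ = _ - X%:Z -> _](_ : _ = #|s|.-1).
  have : (0 < #|s|)%N by apply/card_gt0P; exists k.
  lia.
by rewrite (cardsD1 k s) ks.
Qed.

(** In positive exterior degree both sides vanish at [set0], the case left out in [kdiff_kcone]. *)
Lemma kcard_kdiff_kcone r p (c : kchain r) :
  kcard p.+1 c -> (forall s, kdiff c s = 0) -> kdiff (kcone c) =1 c.
Proof.
move=> h cyc s; case: (eqVneq s set0) => [->|s0]; last exact: kdiff_kcone.
rewrite h ?cards0 //; apply: (@kdiff_card _ p.+1); last by rewrite cards0.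
  exact: kcone_card h.
Qed.

(** The chains that [koszul_acyclic] provides may have components in several exterior degrees; this
    selects one. *)
Definition krestrict r p (c : kchain r) : kchain r :=
  fun s => if #|s| == p then c s else 0.

Lemma kdiff_krestrict r p (c y : kchain r) : kcard p c ->
  (forall s, #|s| = p -> kdiff y s = c s) -> kdiff (krestrict p.+1 y) =1 c.
Proof.
move=> hc hy s; case: (eqVneq #|s| p) => sp; last first.
  rewrite hc // (@kdiff_card _ p) // => s' /negbTE h; by rewrite /krestrict h.
rewrite -hy //; apply: eq_bigr => k ks; rewrite /krestrict cardsU1 ks sp.
by rewrite add1n eqxx.
Qed.

(* Acyclicity of the Koszul complex of the submodule M in exterior degree p
   and internal degree t. For p > 0, all cycles are boundaries in the ambient
   free module F; for p = 0, this is (M \cap mF)_t <= mM, with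
   m = (x_1, ..., x_n). *)
Definition koszul_acyclic r (gd : 'I_r -> int) (M : 'rV[S]_r -> Prop) p t :=
  forall c : kchain r, kcard p c -> khomog gd t c -> (forall s, M (c s)) ->
  (exists y, [/\ kcard p.+1 y, khomog gd t y & kdiff y =1 c]) ->
  exists2 w, forall s, M (w s) & kdiff w =1 c.

Definition mximage r q (A : 'M[S]_(r, q)) : 'rV[S]_q -> Prop :=
  fun v => exists w, v = w *m A.

Lemma mximage_lift r q (A : 'M[S]_(r, q)) (c : kchain q) :
  (forall s, mximage A (c s)) -> exists C, forall s, c s = C s *m A.
Proof. exact: (@fin_all_exists _ (fun=> 'rV[S]_r) (fun s w => c s = w *m A)). Qed.

Definition const_mxpart r q (A : 'M[S]_(r, q)) : 'M[K]_(r, q) :=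
  map_mx (mcoeff 0%MM) A.

Definition at_set0 r (v : 'rV[S]_r) : kchain r :=
  fun s => if s == set0 then v else 0.

Lemma at_set0_card r (v : 'rV[S]_r) : kcard 0%N (at_set0 v).
Proof. by move=> s; rewrite cards_eq0 /at_set0 => /negbTE->. Qed.

Lemma kdiff_set0_const r (c : kchain r) : const_mxpart (kdiff c set0) = 0.
Proof.
apply/rowP => a; rewrite !mxE mcoeff_kdiff big1 // => k.
by rewrite mnm0E andbF.
Qed.

(** At [set0] the homotopy fails only for constant terms, and both sides have none. *)
Lemma const0_kdiff r (v : 'rV[S]_r) : const_mxpart v = 0 ->
  kdiff (kcone (at_set0 v)) =1 at_set0 v.
Proof.
move=> v0 s; case: (eqVneq s set0) => [->|s0]; last first.
  rewrite (@kdiff_card _ 0%N) ?cards_eq0 ?(at_set0_card _) ?cards_eq0 //.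
  exact/kcone_card/at_set0_card.
apply/rowP => a; apply/mpolyP => b; case: (eqVneq b 0%MM) => [->|b0].
  move/rowP/(_ a): (kdiff_set0_const (kcone (at_set0 v))).
  by move/rowP/(_ a): v0; rewrite !mxE /at_set0 eqxx => -> ->.
rewrite -(kcone_homotopy (at_set0 v) a (or_intror b0)) -[LHS]addr0; congr (_ + _).
rewrite summxE raddf_sum big1 //= => m _; rewrite mxE mcoeff_peel.
case: ifP => // _; rewrite mcoeff_kdiff big1 // => k _.
rewrite /at_set0 ifF ?mxE ?mcoeff0 ?mulr0 //.
by apply/eqP => /setP/(_ k); rewrite !inE eqxx.
Qed.

(** * Dimension shifting along an exact sequence *)

Section Shift.
Variables (r' r q : nat) (B : 'M[S]_(r', r)) (A : 'M[S]_(r, q)).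
Variables (gd : 'I_r -> int) (gdq : 'I_q -> int).
Hypothesis homA : row_homog gd gdq A.
Hypothesis exBA : forall v, v *m A = 0 <-> mximage B v.

(** This is the connecting map for 0 -> im B -> F -> im A -> 0, where F is free and [kcone]
    contracts its Koszul complex in positive exterior degree. *)
Lemma koszul_acyclic_shift p t :
  koszul_acyclic gdq (mximage A) p.+1 t <-> koszul_acyclic gd (mximage B) p t.
Proof.
split=> [acA z _ _ zB [y [ycard yhom yz]]|acB c ccard chom cA [y [_ _ yc]]].
  (* For z = dy in im B, the image c of y is a cycle in im A. If c is the image of dW, then y - dW
     lies in ker A = im B and still bounds z. *)
  pose c : kchain q := fun s => y s *m A.
  have ccard : kcard p.+1 c by move=> s /ycard; rewrite /c => ->; rewrite mul0mx.
  have chom : khomog gdq t c by move=> s; apply: deg_in_mulmx homA (yhom s).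
  have cA s : mximage A (c s) by exists (y s).
  have dc s : kdiff c s = 0.
    by rewrite /c kdiff_mulmx yz; apply/exBA.
  have [|w /mximage_lift[W hW] hw] := acA c ccard chom cA.
    exists (kcone c); split; [exact: kcone_card|exact: kcone_homog|].
    exact: kcard_kdiff_kcone ccard dc.
  exists (fun s => y s - kdiff W s) => s.
    apply/exBA; rewrite mulmxBl -kdiff_mulmx -(eq_kdiff hW) hw subrr //.
  by rewrite kdiffB kdiff_kdiff subr0.
(* Conversely, lift c to F by a chain C of the same degrees; dC lies in im B because c is a
   cycle. *)
have [C hC] : exists C : kchain r, forall s, [/\ c s = C s *m A,
    is_homog gd (t - #|s|%:Z) (C s) & #|s| != p.+1 -> C s = 0].
  apply: (@fin_all_exists _ (fun=> 'rV[S]_r) (fun s Cs => [/\ c s = Cs *m A,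
    is_homog gd (t - #|s|%:Z) Cs & #|s| != p.+1 -> Cs = 0])) => s.
  case: (eqVneq #|s| p.+1) => hs; last first.
    by exists 0; split=> //; [rewrite mul0mx ccard|apply: deg_in0].
  have [v hv] := cA s; exists (hcomp gd (t - #|s|%:Z) v); split=> //.
    by rewrite (hcomp_mulmx homA) // -hv.
  exact: hcomp_homog.
have Ccard : kcard p.+1 C by move=> s; case: (hC s).
have Chom : khomog gd t C by move=> s; case: (hC s).
have CA : c =1 fun s => C s *m A by move=> s; case: (hC s).
have [||||Y YB dY] := acB (kdiff C).
- exact: kdiff_card.
- exact: kdiff_homog.
- move=> s; apply/exBA; rewrite -kdiff_mulmx -(eq_kdiff CA) -(eq_kdiff yc).
  exact: kdiff_kdiff.
- by exists C.
(* E is a cycle of F with image c, since A kills Y; the image of its cone bounds c within im A. *)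
pose E : kchain r := fun s => C s - krestrict p.+1 Y s.
have dE s : kdiff E s = 0.
  rewrite kdiffB (@kdiff_krestrict _ p (kdiff C)) ?subrr //.
  exact: kdiff_card.
have Ecard : kcard p.+1 E.
  by move=> s hs; rewrite /E /krestrict (negbTE hs) Ccard // subrr.
exists (fun s => kcone E s *m A) => [s|s]; first by exists (kcone E s).
rewrite kdiff_mulmx (kcard_kdiff_kcone Ecard dE) /E mulmxBl -CA.
rewrite (_ : krestrict _ _ _ *m A = 0) ?subr0 //.
by rewrite /krestrict; case: ifP => _; [apply/exBA|rewrite mul0mx].
Qed.

Definition const_homog t (u : 'rV[K]_r) := forall a, u 0 a != 0 -> gd a = t.

(** Both sides say that w lies in im B + mF, where im B = ker A: the values [kdiff W set0] make up
    mF. N stands for the cycle condition, or for none in homological degree 0. *)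
Lemma fiber_exact_iff t (N : 'rV[K]_r -> Prop) :
  (forall u, const_homog t u -> N u -> exists v, u = v *m const_mxpart B) <->
  (forall w, is_homog gd t w -> N (const_mxpart w) ->
     exists W : kchain r, w *m A = kdiff W set0 *m A).
Proof.
split=> [h w hw Nw|h u hu Nu].
  have [|v hv] := h _ _ Nw.
    move=> a; rewrite mxE -mcoeff_msupp => /hw; by rewrite mdeg0 addr0.
  pose V := map_mx (@mpolyC n K) v.
  have V0 : const_mxpart (w - V *m B) = 0.
    rewrite /const_mxpart map_mxB map_mxM -/(const_mxpart _) hv.
    rewrite (_ : map_mx _ V = v) ?subrr //.
    by apply/rowP => a; rewrite !mxE /= mcoeffC eqxx mulr1.
  exists (kcone (at_set0 (w - V *m B))); rewrite (const0_kdiff V0) /at_set0 eqxx.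
  by rewrite mulmxBl [V *m B *m A](proj2 (exBA _)) ?subr0 //; exists V.
pose w := map_mx (@mpolyC n K) u.
have w0 : const_mxpart w = u.
  by apply/rowP => a; rewrite !mxE /= mcoeffC eqxx mulr1.
have [||W hW] := h w.
- move=> a b; rewrite mxE /= mcoeff_msupp mcoeffC; case: (b =P 0%MM) => [->|_]; last first.
    by rewrite mulr0 eqxx.
  by rewrite mulr1 mdeg0 addr0 => /hu.
- by rewrite w0.
have /exBA[v hv] : (w - kdiff W set0) *m A = 0 by rewrite mulmxBl hW subrr.
exists (const_mxpart v).
rewrite -[RHS]map_mxM -hv map_mxB -/(const_mxpart _) w0.
by rewrite -/(const_mxpart _) kdiff_set0_const subr0.
Qed.

(** The vector wA has no constant term exactly if the constant part of A kills that of w, so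
    [fiber_exact_iff] applies to these w. *)
Lemma koszul_acyclic0 t :
  koszul_acyclic gdq (mximage A) 0%N t <->
  (forall u, const_homog t u -> u *m const_mxpart A = 0 ->
     exists v, u = v *m const_mxpart B).
Proof.
rewrite (fiber_exact_iff t (fun u => u *m const_mxpart A = 0)).
split=> [ac w hw|h c ccard chom cA [y [_ _ yc]]].
  rewrite /const_mxpart -map_mxM -/(const_mxpart _) => wA0.
  have [||||w' /mximage_lift[W hW] hw'] := ac (at_set0 (w *m A)).
  - exact: at_set0_card.
  - move=> s; rewrite /at_set0; case: eqP => [->|_]; last exact: deg_in0.
    by rewrite cards0 subr0; apply: deg_in_mulmx homA hw.
  - move=> s; rewrite /at_set0; case: eqP => _; first by exists w.
    by exists 0; rewrite mul0mx.
  - exists (kcone (at_set0 (w *m A))); split; last exact: const0_kdiff.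
      exact/kcone_card/at_set0_card.
    apply: kcone_homog => s; rewrite /at_set0; case: eqP => [->|_]; last exact: deg_in0.
    by rewrite cards0 subr0; apply: deg_in_mulmx homA hw.
  exists W; have := hw' set0; rewrite (eq_kdiff hW) kdiff_mulmx => ->.
  by rewrite /at_set0 eqxx.
have [v hv] := cA set0.
have chom0 : is_homog gdq t (v *m A) by have := chom set0; rewrite cards0 subr0 hv.
have [||W hW] := h (hcomp gd t v); first exact: hcomp_homog.
  rewrite /const_mxpart -map_mxM -/(const_mxpart _) (hcomp_mulmx homA) //.
  by rewrite -hv -yc kdiff_set0_const.
rewrite (hcomp_mulmx homA) // -hv in hW.
exists (krestrict 1 (fun s => W s *m A)) => [s|].
  rewrite /krestrict; case: ifP => _; first by exists (W s).
  by exists 0; rewrite mul0mx.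
apply: kdiff_krestrict ccard _ => s /eqP; rewrite cards_eq0 => /eqP->.
by rewrite kdiff_mulmx.
Qed.

End Shift.

End Koszul.

(** * Graded Betti numbers and the Koszul complex of the ideal *)

Section Resolution.
Variables (n : nat) (K : fieldType).
Local Notation S := {mpoly K[n]}.
Variables (I : S -> Prop) (F : graded_free_resolution I).

(* The resolution extended by F_(-1) = S, with indices shifted by one. *)
Definition arank i := if i is i'.+1 then rk F i' else 1%N.

Definition adeg i : 'I_(arank i) -> int :=
  match i with 0 => fun=> 0 | i'.+1 => @gdeg _ _ _ F i' end.

Definition adif i : 'M[S]_(arank i.+1, arank i) :=
  match i with 0 => aug F | i'.+1 => dif F i' end.

Lemma adif_homog i : row_homog (@adeg i.+1) (@adeg i) (adif i).
Proof.
case: i => [|i] a a' b /=; last exact: dif_homog.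
by rewrite ord1 => /aug_homog->; rewrite add0r.
Qed.

Lemma adif_exact i v : v *m adif i = 0 <-> mximage (adif i.+1) v.
Proof. by case: i v => [|i] v; [apply: aug_exact|apply: dif_exact]. Qed.

Lemma mximage_aug v : mximage (adif 0) v <-> I (v 0 0).
Proof.
rewrite aug_image; split=> [[w ->]|[w hw]]; first by exists w.
by exists w; apply/rowP => a; rewrite ord1.
Qed.

(** Each step along the resolution trades one exterior degree for one further syzygy module. *)
Lemma koszul_acyclic_adif p t :
  koszul_acyclic (@adeg 0) (mximage (adif 0)) p t <->
  koszul_acyclic (@adeg p) (mximage (adif p)) 0%N t.
Proof.
suff h q i j : j = (i + q)%N ->
    koszul_acyclic (@adeg i) (mximage (adif i)) q t <->
    koszul_acyclic (@adeg j) (mximage (adif j)) 0%N t by exact: h.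
elim: q i j => [|q IHq] i j ->; first by rewrite addn0.
apply: iff_trans (koszul_acyclic_shift (@adif_homog i) (@adif_exact i) q t) _.
by apply: IHq; rewrite addSnnS.
Qed.

Lemma fiber_deg_mul i t (u : 'rV[K]_(rk F i)) :
  reflect (const_homog (@gdeg _ _ _ F i) t u) (u *m fiber_deg F i t == u).
Proof.
apply: (iffP eqP) => [/rowP h a|h].
  move: (h a); rewrite mul_mx_diag !mxE; case: eqP => // _.
  by rewrite mulr0 => <-; rewrite eqxx.
apply/rowP => a; rewrite mul_mx_diag !mxE; have := h a.
case: (u 0 a =P 0) => [->|_ /(_ isT)->]; first by rewrite mul0r.
by rewrite eqxx mulr1.
Qed.

(** A nonzero constant entry of [dif] joins basis elements of equal degree. *)
Lemma fiber_deg_comm i t :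
  fiber_deg F i.+1 t *m fiber_dif F i = fiber_dif F i *m fiber_deg F i t.
Proof.
apply/matrixP => a b; rewrite /fiber_deg mul_mx_diag mul_diag_mx !mxE.
case: (boolP (0%MM \in msupp (dif F i a b))) => h; last first.
  by rewrite (memN_msupp_eq0 h) mulr0 mul0r.
by rewrite (dif_homog h) mdeg0 addr0 mulrC.
Qed.

(** The complex computing Tor ends in F_0, without the augmentation, so every vector is a cycle in
    degree 0. *)
Definition fiber_cycle i (u : 'rV[K]_(rk F i)) : Prop :=
  u *m const_mxpart (adif i) = 0 \/ i = 0%N.

Lemma graded_betti_eq0 i t :
  graded_betti F i t = 0%N <->
  (forall u, const_homog (@gdeg _ _ _ F i) t u -> fiber_cycle u ->
     exists v, u = v *m const_mxpart (dif F i)).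
Proof.
have cycP (u : 'rV_(rk F i)) : (u <= tor_cycles F i t)%MS <->
    const_homog (@gdeg _ _ _ F i) t u /\ fiber_cycle u.
  have degP : (u <= fiber_deg F i t)%MS <-> const_homog (@gdeg _ _ _ F i) t u.
    split=> [/submxP[v ->]|/fiber_deg_mul/eqP <-]; last exact: submxMl.
    apply/fiber_deg_mul; rewrite -mulmxA; apply/eqP; congr (_ *m _).
    rewrite /fiber_deg mul_mx_diag; apply/matrixP => a b; rewrite !mxE.
    by case: (a =P b) => [->|_]; case: eqP; rewrite ?mulr1n ?mulr0n ?mulr1 ?mulr0 ?mul0r.
  rewrite -degP /fiber_cycle; move: u {degP}; case: i => [|i] u /=.
    by split=> [->|[]//]; split=> //; right.
  rewrite sub_capmx; split=> [/andP[-> /sub_kermxP ?]|[-> [/sub_kermxP|//]]//].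
  by split=> //; left.
have -> : graded_betti F i t = 0%N <->
    (tor_cycles F i t <= tor_boundaries F i t)%MS.
  have := mxrank_leqif_sup (tor_boundaries_sub F i t).
  rewrite /graded_betti => -[_ <-].
  split=> [/eqP|/eqP->]; last exact: subnn.
  by rewrite subn_eq0 eqn_leq => ->; rewrite mxrankS // tor_boundaries_sub.
split=> [h u hu cu|h].
  have /submxP[v ->] := submx_trans (proj2 (cycP u) (conj hu cu)) h.
  by exists (v *m fiber_deg F i.+1 t); rewrite mulmxA.
(* The preimage v need not be homogeneous, but projecting it to degree t does not change its image
   u. *)
apply/rV_subP => u /cycP[hu cu]; have [v uv] := h u hu cu.
apply/submxP; exists v; rewrite /tor_boundaries fiber_deg_comm mulmxA.
by rewrite -[v *m _]uv; apply/esym/eqP/fiber_deg_mul.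
Qed.

(** The right side says that I_t lies in mI, that is, no minimal generator has degree t. *)
Lemma graded_betti0_eq0 t :
  graded_betti F 0 t = 0%N <->
  (forall w, is_homog (@gdeg _ _ _ F 0) t w ->
     exists W : kchain n K (rk F 0), w *m aug F = kdiff W set0 *m aug F).
Proof.
rewrite graded_betti_eq0.
have := fiber_exact_iff (B := dif F 0) (A := aug F) (@gdeg _ _ _ F 0)
  (@adif_exact 0) t (fun=> True).
case=> h1 h2; split=> h.
  by move=> w hw; apply: h1 => // u hu _; apply: h => //; right.
by move=> u hu _; apply: h2 => // w hw _; apply: h.
Qed.

Lemma koszul_acyclic_betti i t :
  graded_betti F i t = 0%N ->
  koszul_acyclic (@adeg 0) (mximage (adif 0)) i t.
Proof.
rewrite graded_betti_eq0 koszul_acyclic_adif => h.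
apply/(koszul_acyclic0 (@adif_homog i) (@adif_exact i)) => u hu cu.
by apply: h => //; left.
Qed.

(** Index 0 is left out: acyclicity in exterior degree 0 only tests elements of I without constant
    term, and so misses the generator 1 of the unit ideal. *)
Lemma betti_koszul_acyclic i t :
  koszul_acyclic (@adeg 0) (mximage (adif 0)) i.+1 t ->
  graded_betti F i.+1 t = 0%N.
Proof.
rewrite graded_betti_eq0 koszul_acyclic_adif.
move/(koszul_acyclic0 (@adif_homog i.+1) (@adif_exact i.+1)) => h u hu [cu|//].
exact: h.
Qed.

End Resolution.

(** * Monomial ideals *)

Section MonomialIdeals.
Variables (n : nat) (K : fieldType).
Local Notation S := {mpoly K[n]}.
Implicit Types (I J : S -> Prop) (G : 'X_{1..n} -> Prop) (b : 'X_{1..n}).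

Definition spanned_by I G := forall f, I f <-> forall b, b \in msupp f -> G b.

Definition up_closed G := forall b b', G b -> G (b' + b)%MM.

Lemma spanned_byX I G b : spanned_by I G -> I 'X_[b] <-> G b.
Proof.
move=> hI; rewrite hI; split=> [|Gb b']; first by apply; rewrite msuppX inE.
by rewrite msuppX inE => /eqP->.
Qed.

Lemma spanned_by0 I G : spanned_by I G -> I 0.
Proof. by move=> hI; apply/hI => b; rewrite mcoeff_msupp mcoeff0 eqxx. Qed.

Lemma spanned_byD I G f g : spanned_by I G -> I f -> I g -> I (f + g).
Proof.
move=> hI /hI hf /hI hg; apply/hI => b /msuppD_le.
by rewrite mem_cat => /orP[/hf|/hg].
Qed.

Lemma spanned_byM I G f g : spanned_by I G -> up_closed G -> I f -> I (g * f).
Proof.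
move=> hI hG /hI hf; apply/hI => b.
by case/msuppM_le/allpairsP => -[b1 b2] /= [_ /hf h2 ->]; apply: hG.
Qed.

Lemma spanned_by_sum I G (T : eqType) (r : seq T) (P : pred T) (f : T -> S) :
  spanned_by I G -> (forall x, x \in r -> P x -> I (f x)) ->
  I (\sum_(x <- r | P x) f x).
Proof.
move=> hI hf; rewrite big_seq_cond.
apply: (big_ind I); first exact: (spanned_by0 hI).
  by move=> *; apply: (spanned_byD hI).
by move=> x /andP[]; apply: hf.
Qed.

Lemma ideal_span_spanned I G H f g : spanned_by I G -> up_closed G ->
  (forall h, H h -> I (f * h)) -> ideal_span H g -> I (f * g).
Proof.
move=> hI hG hH [s hs ->]; rewrite mulr_sumr.
apply: (spanned_by_sum hI) => p /hs /hH hp _.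
by rewrite mulrCA; apply: (spanned_byM _ hI hG).
Qed.

Lemma ideal_spanX H (f : S) : (forall b, b \in msupp f -> H 'X_[b]) ->
  ideal_span H f.
Proof.
move=> hH; exists [seq ((f@_b)%:MP, 'X_[b]) | b <- msupp f].
  by move=> p /mapP[b /hH ? ->].
rewrite big_map {1}[f]mpolyE; apply: eq_bigr => b _.
by rewrite /= mul_mpolyC.
Qed.

Lemma ideal_spanD H (f g : S) :
  ideal_span H f -> ideal_span H g -> ideal_span H (f + g).
Proof.
move=> [s hs ->] [s' hs' ->]; exists (s ++ s'); last by rewrite big_cat.
by move=> p; rewrite mem_cat => /orP[/hs|/hs'].
Qed.

Lemma ideal_spanM H (f g : S) : ideal_span H f -> ideal_span H (g * f).
Proof.
move=> [s hs ->]; exists [seq (g * p.1, p.2) | p <- s].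
  by move=> p /mapP[q /hs ? ->].
by rewrite big_map mulr_sumr; apply: eq_bigr => p _; rewrite mulrA.
Qed.

Lemma ideal_span_gen H (g : S) : H g -> ideal_span H g.
Proof.
move=> Hg; exists [:: (1, g)]; last by rewrite big_seq1 mul1r.
by move=> p; rewrite inE => /eqP->.
Qed.

Lemma monomial_ideal_spanned I : monomial_ideal I ->
  spanned_by I (fun b => I 'X_[b]) /\ up_closed (fun b => I 'X_[b]).
Proof.
case=> M hM.
have IM g f : I f -> I (g * f) by rewrite !hM; apply: ideal_spanM.
split=> [f|b b' Ib]; last by rewrite mpolyXD; apply: IM.
split=> [/hM[s hs ->] b|hf].
  case/msupp_sum_le/flattenP => x /mapP[p]; rewrite mem_filter /=.
  move=> /hs[m Mm ->] -> /msuppM_le/allpairsP[[b1 b2] /= [_]].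
  rewrite msuppX inE => /eqP -> ->; rewrite mpolyXD; apply/IM/hM.
  by apply: ideal_span_gen; exists m.
rewrite [f]mpolyE big_seq_cond; apply: (big_ind I).
- by apply/hM; exists [::]; rewrite ?big_nil.
- by move=> g h; rewrite !hM; apply: ideal_spanD.
- by move=> b /andP[/hf Ib _]; rewrite -mul_mpolyC; apply: IM.
Qed.

Definition msum G G' b := exists b1 b2, [/\ b = (b1 + b2)%MM, G b1 & G' b2].

Lemma ideal_mul_spanned I J G G' :
  spanned_by I G -> spanned_by J G' -> up_closed G ->
  spanned_by (ideal_mul I J) (msum G G').
Proof.
move=> hI hJ hG f; split=> [[s hs ->] b|hf].
  case/msupp_sum_le/flattenP => x /mapP[p]; rewrite mem_filter /=.
  move=> /hs[g [h [/hI Ig /hJ Jh ->]]] ->.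
  case/msuppM_le/allpairsP => -[b0 b'] /= [_ + ->].
  case/msuppM_le/allpairsP => -[b1 b2] /= [/Ig h1 /Jh h2 ->].
  by exists (b0 + b1)%MM, b2; split=> //; [rewrite addmA|apply: hG].
apply: ideal_spanX => b /hf[b1 [b2 [-> h1 h2]]].
exists 'X_[b1], 'X_[b2]; split; rewrite ?mpolyXD //.
  exact/(spanned_byX _ hI).
exact/(spanned_byX _ hJ).
Qed.

(** * Divisibility by the last variable, and products *)

Definition last_div G (r : int) := forall b, G b -> r < (mdeg b)%:Z ->
  exists m, [/\ (0 < b m)%N, supp_le m b & G (b - U_(m))%MM].

Lemma supp_le_uniq m k b : (0 < b m)%N -> (0 < b k)%N ->
  supp_le m b -> supp_le k b -> m = k.
Proof.
move=> bm bk /supp_leP hm /supp_leP hk; apply: val_inj => /=.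
by case: (ltngtP m k) => // [/hm e|/hk e]; rewrite e in bm bk.
Qed.

Lemma supp_leD m b b' : supp_le m (b + b')%MM = supp_le m b && supp_le m b'.
Proof.
apply/supp_leP/andP => [h|[/supp_leP h /supp_leP h'] l ml]; last first.
  by rewrite mnmDE h ?h'.
by split; apply/supp_leP => l /h; rewrite mnmDE; lia.
Qed.

(** Induction on deg b1: moving the last variable of b1 to b2 lowers it and preserves the
    product. *)
Lemma last_div_msum_aux G G' r r' b1 b2 m :
  up_closed G' -> last_div G r -> last_div G' r' ->
  G b1 -> G' b2 -> r + r' < (mdeg (b1 + b2))%:Z ->
  (0 < b2 m)%N -> supp_le m (b1 + b2) ->
  msum G G' (b1 + b2 - U_(m))%MM.
Proof.
move=> hG' dG dG'; move e : (mdeg b1) => d.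
elim: d b1 b2 e => [|d IHd] b1 b2 e Gb1 Gb2 hd bm hm.
all: have [hd2|hd2] := ltrP r' (mdeg b2)%:Z.
(* If deg b2 > r', the last variable of b2 is x_m, as x_m divides b2 and no later variable divides
   the product. *)
1,3: have [k [bk hk Gk]] := dG' _ Gb2 hd2.
1,2: have -> : m = k by apply: supp_le_uniq bm bk _ hk;
       move: hm; rewrite supp_leD => /andP[].
1,2: exists b1, (b2 - U_(k))%MM; split=> //; apply/mnmP => l;
     rewrite !(mnmDE, mnmBE, mnm1E); case: (k =P l) bk => [->|_]; lia.
all: have hd1 : r < (mdeg b1)%:Z by move: hd; rewrite mdegD; lia.
all: have [k [bk hk Gk]] := dG _ Gb1 hd1.
  by move: bk; move/eqP: e; rewrite mdeg_eq0 => /eqP->; rewrite mnm0E.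
have b1E : (b1 - U_(k) + U_(k) = b1)%MM by rewrite submK // lep1mP -lt0n.
have b12 : (b1 + b2 = (b1 - U_(k)) + (U_(k) + b2))%MM by rewrite addmA b1E.
rewrite b12; apply: IHd; rewrite -?b12 //.
- by move: e; rewrite -{1}b1E mdegD mdeg1; lia.
- exact: hG'.
- by rewrite mnmDE; lia.
Qed.

Lemma msumC G G' b : msum G G' b -> msum G' G b.
Proof. by case=> b1 [b2 [-> h1 h2]]; exists b2, b1; rewrite addmC. Qed.

Lemma last_div_msum G G' r r' : up_closed G -> up_closed G' ->
  last_div G r -> last_div G' r' -> last_div (msum G G') (r + r').
Proof.
move=> hG hG' dG dG' b [b1 [b2 [-> G1 G2]]] hd.
(* The bounds may be negative. If b1 = b2 = 1, one of them is, and [last_div] would divide 1 by a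
   variable. *)
have nz : (b1 + b2)%MM != 0%MM.
  rewrite mnmD_eq0; apply/negP => /andP[/eqP z1 /eqP z2].
  have [h|h] := ltrP r (mdeg b1)%:Z.
    by have [k []] := dG _ G1 h; rewrite z1 mnm0E.
  have h2 : r' < (mdeg b2)%:Z by move: hd; rewrite mdegD; lia.
  by have [k []] := dG' _ G2 h2; rewrite z2 mnm0E.
have [m [+ hm]] := @last_in_ex n set0 _ (or_intror nz); rewrite inE /= => bm.
have hl : supp_le m (b1 + b2) by apply/supp_leP => l /hm[].
(* If x_m does not divide b2, it divides b1, and the factors are exchanged. *)
exists m; split=> //; case: (posnP (b2 m)) => b2m.
  rewrite addmC; apply/msumC/(last_div_msum_aux hG dG' dG) => //.
  - by rewrite addmC addrC.
  - by move: bm; rewrite mnmDE b2m addn0.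
  - by rewrite addmC.
exact: last_div_msum_aux hG' dG dG' _ _ _ _ _.
Qed.

(** * From divisibility to vanishing Betti numbers *)

(** The coefficients of c have degree t - p > e, so their monomials may be divided by their last
    variable within I. *)
Lemma kcone_spanned I G e p t (c : kchain n K 1) :
  spanned_by I G -> last_div G e -> e < t - p%:Z ->
  kcard p c -> khomog (fun=> 0) t c -> (forall s, I (c s 0 0)) ->
  forall s, I (kcone c s 0 0).
Proof.
move=> hI dG ept cp ct cI s; apply/hI => b; rewrite summxE.
move/msupp_sum_le/flattenP => [x /mapP[k]]; rewrite mem_filter => _ ->.
rewrite mxE mcoeff_msupp mcoeff_peel; case: ifP => [hk|]; last by rewrite eqxx.
rewrite -mcoeff_msupp => hb; have hkb : supp_le k (b + U_(k)).
  rewrite supp_leD hk /=; apply/supp_leP => l; rewrite mnm1E.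
  by case: eqP => // ->; rewrite ltnn.
have [|m [bm hm Gm]] := dG _ (proj1 (hI _) (cI _) _ hb).
  have sp : #|s :\ k| = p.
    apply: contraTeq hb => /cp->; by rewrite mxE mcoeff_msupp mcoeff0 eqxx.
  by move: (ct _ _ _ hb); rewrite sp add0r => ->.
suff mk : m = k by move: Gm; rewrite mk addmK.
by apply: supp_le_uniq bm _ hm hkb; rewrite mnmDE mnm1E eqxx addn1.
Qed.

(** The cone of a cycle in I stays in I and bounds it. For i = 0, the cone of an element f of I_t
    shows that f is in mI. *)
Lemma last_div_betti I G e (F : graded_free_resolution I) i t :
  spanned_by I G -> last_div G e -> e < t - i%:Z -> graded_betti F i t = 0%N.
Proof.
move=> hI dG; case: i => [|i] eit.
  apply/graded_betti0_eq0 => w hw; set f := w *m aug F.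
  have hf : is_homog (fun=> 0) t f.
    exact: deg_in_mulmx (@adif_homog _ _ _ F 0%N) hw.
  have If : I (f 0 0) by apply/(@mximage_aug _ _ _ F _); exists w.
  (* A constant term of f would put 1 in G with e < t = 0, but no variable divides 1. *)
  have f0 : const_mxpart f = 0.
    apply/rowP => a; rewrite ord1 [LHS]mxE [RHS]mxE; apply/eqP.
    rewrite mcoeff_eq0.
    apply/negP => h0; have := hf _ _ h0; rewrite add0r => ht.
    have [|m []] := dG _ (proj1 (hI _) If _ h0); last by rewrite mnm0E.
    by move: eit; rewrite subr0 -ht.
  have imk s : mximage (adif F 0%N) (kcone (at_set0 f) s).
    apply/mximage_aug.
    apply: (kcone_spanned hI dG eit (@at_set0_card _ _ _ f)) => s'.
      rewrite /at_set0; case: eqP => [->|_]; last exact: deg_in0.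
      by rewrite cards0 subr0.
    by rewrite /at_set0; case: eqP => // _; rewrite mxE; apply: (spanned_by0 hI).
  have [W hW] : exists W, forall s, kcone (at_set0 f) s = W s *m aug F.
    exact: mximage_lift imk.
  exists W; rewrite -kdiff_mulmx -(eq_kdiff hW) (const0_kdiff f0) /at_set0.
  by rewrite eqxx.
apply: betti_koszul_acyclic => c cp ct cI [y [_ _ yc]].
exists (kcone c) => [s|].
  apply/mximage_aug; apply: (kcone_spanned hI dG eit cp ct) => s'.
  exact/mximage_aug.
apply: kcard_kdiff_kcone cp _ => s; rewrite -(eq_kdiff yc).
exact: kdiff_kdiff.
Qed.

(* A monomial v in the variables up to x_m representing a socle element of
   S / I modulo the later variables gives the Koszul cycle d(v e_0 ... e_m). *)
Lemma socle_betti I G (F : graded_free_resolution I) m v :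
  spanned_by I G -> up_closed G -> supp_le m v -> ~ G v ->
  (forall l : 'I_n, (l <= m)%N -> G (v + U_(l))%MM) ->
  exists i t, graded_betti F i t <> 0%N /\ t - i%:Z = (mdeg v).+1%:Z.
Proof.
move=> hI hG hm nGv hl; pose s0 := [set l : 'I_n | (l <= m)%N].
have ms0 : m \in s0 by rewrite inE.
pose p := #|s0|.-1; have ps0 : #|s0| = p.+1 by rewrite prednK // (cardD1 m) ms0.
exists p, (mdeg v + #|s0|)%N%:Z; split; last by rewrite ps0; lia.
move/koszul_acyclic_betti => ac.
pose y : kchain n K 1 := fun s => if s == s0 then const_mx 'X_[v] else 0.
have ycard : kcard p.+1 y.
  by move=> s; rewrite /y -ps0; case: (s =P s0) => // ->; rewrite eqxx.
have yhom : khomog (@adeg _ _ _ F 0) (mdeg v + #|s0|)%N%:Z y.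
  move=> s; rewrite /y; case: eqP => [->|_]; last exact: deg_in0.
  by move=> a b; rewrite mxE msuppX inE => /eqP->; rewrite add0r PoszD addrK.
have [||s||w wI hw] := ac (kdiff y).
- exact: kdiff_card.
- exact: kdiff_homog.
- apply/mximage_aug; rewrite summxE; apply: (spanned_by_sum hI) => k _ ks.
  rewrite mxE /y; case: eqP => [e|_]; last first.
    by rewrite mxE mulr0; apply: (spanned_by0 hI).
  rewrite mxE -scalerAl -mpolyXD -mul_mpolyC.
  apply: (spanned_byM _ hI hG); apply/(spanned_byX _ hI); rewrite addmC.
  by apply: hl; have := setU11 k s; rewrite e inE.
- by exists y.
pose E : kchain n K 1 := fun s => y s - krestrict p.+1 w s.
have Ecard : kcard p.+1 E.
  by move=> s hs; rewrite /E /krestrict (negbTE hs) ycard // subrr.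
have dE s : kdiff E s = 0.
  rewrite kdiffB (@kdiff_krestrict _ _ _ p (kdiff y)) ?subrr //.
  exact: kdiff_card.
(* E is the boundary of its cone, so its coefficient at [s0] is a combination of the variables after
   x_m. None divides v, hence v has coefficient 1 in [w s0], which is in I. *)
have := mcoeff_kdiff (kcone E) s0 0 v.
rewrite (kcard_kdiff_kcone Ecard dE) big1 => [|k /andP[]]; last first.
  by rewrite inE -ltnNge => /(supp_leP _ _ hm)->.
rewrite /E /y /krestrict ps0 !eqxx !mxE mcoeffB mcoeffX eqxx => /eqP.
rewrite subr_eq0 => /eqP hv; apply: nGv.
have /mximage_aug/hI := wI s0; apply.
by rewrite mcoeff_msupp -hv oner_neq0.
Qed.

(** * Ideals of Borel type *)

Lemma ideal_pow_vars m k b : supp_le m b -> mdeg b = k ->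
  ideal_pow (vars_upto_ideal m) k ('X_[b] : S).
Proof.
elim: k b => [//|k IHk] b hm hb.
have [l bl] : exists l, (0 < b l)%N.
  case: (pickP (fun l => (0 < b l)%N)) => [l ?|h]; first by exists l.
  suff e : b = 0%MM by rewrite e mdeg0 in hb.
  by apply/mnmP => l; rewrite mnm0E; move: (h l); lia.
have bE : (U_(l) + (b - U_(l)) = b)%MM by rewrite addmC submK // lep1mP -lt0n.
apply: ideal_span_gen; exists 'X_l, 'X_[b - U_(l)]; split.
- apply: ideal_span_gen; exists l => //; rewrite leqNgt; apply/negP => ml.
  by rewrite (supp_leP _ _ hm _ ml) in bl.
- apply: IHk; first by move: hm; rewrite -{1}bE supp_leD => /andP[].
  by move: hb; rewrite -{1}bE mdegD mdeg1; lia.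
- by rewrite -mpolyXD bE.
Qed.

(** By the Borel condition some k puts w u in I for all monomials u of degree k in the variables up
    to x_m. Multiplying w by such variables while staying outside I therefore stops. *)
Lemma borel_socle I m w : borel_type I -> supp_le m w ->
  ~ I 'X_[w] -> I 'X_[w + U_(m)] ->
  exists v, [/\ supp_le m v, (mdeg w <= mdeg v)%N, ~ I 'X_[v] &
    forall l : 'I_n, (l <= m)%N -> I 'X_[v + U_(l)]].
Proof.
move=> [/monomial_ideal_spanned[hI hG] hB] hw nIw Iwm.
have /hB[k _ hk] : ideal_saturation I (var_ideal m) 'X_[w].
  exists 1%N => // g; apply: (ideal_span_spanned hI hG) => h [f1 [f2 [hf1 _ ->]]].
  rewrite mulrA [_ * f2]mulrC; apply: (spanned_byM _ hI hG).
  by apply: (ideal_span_spanned hI hG) hf1 => _ ->; rewrite -mpolyXD.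
have {}hk u : supp_le m u -> mdeg u = k -> I 'X_[w + u].
  by move=> hu uk; rewrite mpolyXD; apply/hk/ideal_pow_vars.
(* Here d = k - deg u bounds the number of multiplications left. *)
suff H d u : supp_le m u -> (mdeg u + d)%N = k -> ~ I 'X_[w + u] ->
    exists v, [/\ supp_le m v, (mdeg w <= mdeg v)%N, ~ I 'X_[v] &
      forall l : 'I_n, (l <= m)%N -> I 'X_[v + U_(l)]].
  apply: (H k 0%MM); rewrite ?mdeg0 ?addm0 //.
  by apply/supp_leP => l _; rewrite mnm0E.
elim: d u => [|d IHd] u hu uk nI; first by case: nI; apply: hk; rewrite -?uk ?addn0.
case: (classic (exists2 l : 'I_n, (l <= m)%N & ~ I 'X_[w + u + U_(l)])).
  case=> l lm; rewrite -addmA => nIl; apply: (IHd (u + U_(l))%MM) => //.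
    rewrite supp_leD hu; apply/supp_leP => l' ml'; rewrite mnm1E.
    by case: eqP => // e; move: ml'; rewrite -e ltnNge lm.
  by rewrite mdegD mdeg1 -uk addn1 addSnnS.
move=> h; exists (w + u)%MM; split=> //; first by rewrite supp_leD hw.
  by rewrite mdegD leq_addr.
by move=> l lm; apply: NNPP => nIl; apply: h; exists l.
Qed.

Lemma borel_last_div I (F : graded_free_resolution I) r : borel_type I ->
  (forall i t, graded_betti F i t != 0%N -> t - i%:Z <= r) ->
  last_div (fun b => I 'X_[b]) r.
Proof.
move=> hB hr b Ib rb; have [hI hG] := monomial_ideal_spanned (proj1 hB).
(* If b = 1, then r < 0, so no generator has degree 0; but 1 is in I and not in mI. *)
have b0 : b != 0%MM.
  apply/eqP => b0; rewrite b0 mdeg0 in Ib rb.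
  have /graded_betti0_eq0 h : graded_betti F 0 0 = 0%N.
    by apply/eqP/negPn/negP => /hr; rewrite subrr leNgt rb.
  have [w hw] : mximage (aug F) (const_mx 'X_[0%MM]).
    by apply/(@mximage_aug _ _ _ F _); rewrite mxE.
  have hom1 : is_homog (@adeg _ _ _ F 0) 0 (w *m aug F).
    move=> a b'; rewrite -hw mxE msuppX inE => /eqP->; by rewrite mdeg0.
  have [|W] := h (hcomp (@gdeg _ _ _ F 0) 0 w); first exact: hcomp_homog.
  rewrite (hcomp_mulmx (@adif_homog _ _ _ F 0%N)) // -hw -kdiff_mulmx.
  move/(congr1 (@const_mxpart _ _ _ _)); rewrite kdiff_set0_const.
  move/rowP/(_ 0); rewrite !mxE mcoeffX eqxx => /eqP; by rewrite oner_eq0.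
have [m [+ hm]] := @last_in_ex n set0 _ (or_intror b0); rewrite inE /= => bm.
have hl : supp_le m b by apply/supp_leP => l /hm[].
have bE : (b - U_(m) + U_(m) = b)%MM by rewrite submK // lep1mP -lt0n.
exists m; split=> //; apply: NNPP => nI.
have [||v [hv dv nIv Iv]] := @borel_socle I m (b - U_(m))%MM hB _ nI.
- by move: hl; rewrite -{1}bE supp_leD => /andP[].
- by rewrite bE.
have [i [t [/eqP/hr hit e]]] := socle_betti F hI hG hv nIv Iv.
(* The Betti number found gives deg v + 1 <= r, whereas deg v + 1 >= deg b > r. *)
move: dv rb hit; rewrite e -{2}bE mdegD mdeg1; lia.
Qed.

End MonomialIdeals.

Theorem theorem1p7 (K : fieldType) (K_infinite : forall s : seq K, exists x : K, x \notin s)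
  (n : nat) (n_ge2 : (2 <= n)%N)
  (I J : {mpoly K[n]} -> Prop)
  (I_borel : borel_type I) (I_neq0 : nonzero_ideal I)
  (J_borel : borel_type J) (J_neq0 : nonzero_ideal J)
  (rI rJ rIJ : int)
  (reg_I : is_regularity I rI) (reg_J : is_regularity J rJ)
  (reg_IJ : is_regularity (ideal_mul I J) rIJ) :
  rIJ <= rI + rJ.
Proof.
have [FI [_ hFI]] := reg_I; have [FJ [_ hFJ]] := reg_J.
have [F [[i [t [bit ->]]] _]] := reg_IJ.
have [sI uI] := monomial_ideal_spanned (proj1 I_borel).
have [sJ uJ] := monomial_ideal_spanned (proj1 J_borel).
have dI := borel_last_div I_borel hFI.
have dJ := borel_last_div J_borel hFJ.
rewrite leNgt; apply: contra bit => hit; apply/eqP.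
exact: last_div_betti (ideal_mul_spanned sI sJ uI) (last_div_msum uI uJ dI dJ) hit.
Qed.
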